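(* Consider the source coding problem with receiver side information described in the context, let $\mathcal{R}$ be its set of achievable rate triples, and let $\mathcal{R}_{in}$ be as defined in the context. Then $\mathcal{R}\supseteq\mathcal{R}_{in}$.
   Context: Let $\mathcal{X},\mathcal{Y},\mathcal{U},\mathcal{V}$ be finite sets and let $\{(X_i,Y_i,U_i,V_i)\}_{i\ge1}$ be i.i.d. with joint distribution $\mathcal{Q}_{XYUV}$. For $i=0,1,2$ let $\mathcal{M}_i=\{1,\dots,|\mathcal{M}_i|\}$ be finite index sets. A code of block length $n$ consists of an encoder $e^{(n)}:\mathcal{X}^n\times\mathcal{Y}^n\to\mathcal{M}_0\times\mathcal{M}_1\times\mathcal{M}_2$, $(M_0,M_1,M_2)=e^{(n)}(X^n,Y^n)$, a decoder $d_x^{(n)}:\mathcal{M}_0\times\mathcal{M}_1\times\mathcal{U}^n\to\mathcal{X}^n$, $\widehat X^n=d_x^{(n)}(M_0,M_1,U^n)$, and a decoder $d_y^{(n)}:\mathcal{M}_0\times\mathcal{M}_2\times\mathcal{V}^n\to\mathcal{Y}^n$, $\widehat Y^n=d_y^{(n)}(M_0,M_2,V^n)$. Let $P_e=\max\{\Pr[\widehat X^n\ne X^n],\Pr[\widehat Y^n\ne Y^n]\}$. A triple $(R_0,R_1,R_2)$ is achievable if for every $\epsilon>0$ and all sufficiently large $n$ there is such a code with $P_e\le\epsilon$ and $(1/n)\log_2|\mathcal{M}_i|\le R_i+\epsilon$, $i=0,1,2$; $\mathcal{R}$ is the set of achievable triples. Let $\mathcal{W}$ be a finite set with $|\mathcal{W}|\le|\mathcal{X}||\mathcal{Y}|+3$,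 and let $\mathcal{P}$ be the family of probability functions $p$ on $\mathcal{W}\times\mathcal{X}\times\mathcal{Y}\times\mathcal{U}\times\mathcal{V}$ with $p(w,x,y,u,v)=p(w|x,y)p(x,y,u,v)$ and $\sum_w p(w,x,y,u,v)=\mathcal{Q}_{XYUV}(x,y,u,v)$. For $p\in\mathcal{P}$ let $\mathcal{R}_{in}^{(p)}$ be the set of $(R_0,R_1,R_2)$ with $R_0\ge\max\{I_p(X,Y;W|U),I_p(X,Y;W|V)\}$, $R_1\ge H_p(X|W,U)$, $R_2\ge H_p(Y|W,V)$, and let $\mathcal{R}_{in}$ be the closure of $\bigcup_{p\in\mathcal{P}}\mathcal{R}_{in}^{(p)}$. *)

(* Defs.v *)
From HB Require Import structures.
From mathcomp Require Import all_boot all_order all_algebra.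
From mathcomp Require Import all_classical all_reals.
From mathcomp Require Import topology normedtype exp.
Import numFieldNormedType.Exports.
Set Implicit Arguments. Unset Strict Implicit. Unset Printing Implicit Defensive.
Import Order.TTheory GRing.Theory Num.Theory.
Local Open Scope ring_scope.
Local Open Scope classical_set_scope.

Section Defs.
Variable R : realType.

Definition log2 (x : R) : R := ln x / ln 2.

Section Info.
Variable T : finType.
Variable p : T -> R.

Definition law (A : finType) (f : T -> A) (a : A) : R :=
  \sum_(t | f t == a) p t.

Definition pairRV (A B : finType) (f : T -> A) (g : T -> B) : T -> A * B :=
  fun t => (f t, g t).

Definition cond_entropy (A B : finType) (f : T -> A) (g : T -> B) : R :=
  - \sum_(a : A) \sum_(b : B)
      law (pairRV f g) (a, b) * log2 (law (pairRV f g) (a, b) / law g b).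

Definition cond_mutinfo (A B C : finType) (f : T -> A) (g : T -> B) (h : T -> C) : R :=
  \sum_(a : A) \sum_(b : B) \sum_(c : C)
     law (pairRV (pairRV f g) h) ((a, b), c) *
     log2 (law (pairRV (pairRV f g) h) ((a, b), c) * law h c /
           (law (pairRV f h) (a, c) * law (pairRV g h) (b, c))).
End Info.

Section Problem.
Variables X Y U V : finType.
Variable Q : X * Y * U * V -> R.

Definition is_pmf (T : finType) (q : T -> R) : Prop :=
  (forall t, 0 <= q t) /\ \sum_t q t = 1.

Definition iid_prob (n : nat) (E : pred {ffun 'I_n -> X * Y * U * V}) : R :=
  \sum_(s : {ffun 'I_n -> X * Y * U * V} | E s) \prod_(i < n) Q (s i).

Definition seqX n (s : {ffun 'I_n -> X * Y * U * V}) : {ffun 'I_n -> X} :=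
  [ffun i => (s i).1.1.1].
Definition seqY n (s : {ffun 'I_n -> X * Y * U * V}) : {ffun 'I_n -> Y} :=
  [ffun i => (s i).1.1.2].
Definition seqU n (s : {ffun 'I_n -> X * Y * U * V}) : {ffun 'I_n -> U} :=
  [ffun i => (s i).1.2].
Definition seqV n (s : {ffun 'I_n -> X * Y * U * V}) : {ffun 'I_n -> V} :=
  [ffun i => (s i).2].

Record code (n m0 m1 m2 : nat) := Code {
  enc : {ffun 'I_n -> X} -> {ffun 'I_n -> Y} -> 'I_m0 * 'I_m1 * 'I_m2;
  dec_x : 'I_m0 -> 'I_m1 -> {ffun 'I_n -> U} -> {ffun 'I_n -> X};
  dec_y : 'I_m0 -> 'I_m2 -> {ffun 'I_n -> V} -> {ffun 'I_n -> Y} }.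

Definition err_x n m0 m1 m2 (c : code n m0 m1 m2) : R :=
  iid_prob (fun s =>
    let M := enc c (seqX s) (seqY s) in
    dec_x c M.1.1 M.1.2 (seqU s) != seqX s).

Definition err_y n m0 m1 m2 (c : code n m0 m1 m2) : R :=
  iid_prob (fun s =>
    let M := enc c (seqX s) (seqY s) in
    dec_y c M.1.1 M.2 (seqV s) != seqY s).

Definition Pe n m0 m1 m2 (c : code n m0 m1 m2) : R :=
  Num.max (err_x c) (err_y c).

Definition achievable (r : R * R * R) : Prop :=
  forall eps : R, 0 < eps ->
  exists N : nat, forall n : nat, (N <= n)%N ->
  exists m0 m1 m2 : nat, exists c : code n m0 m1 m2,
    [/\ Pe c <= eps,
        log2 m0%:R / n%:R <= r.1.1 + eps,
        log2 m1%:R / n%:R <= r.1.2 + eps &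
        log2 m2%:R / n%:R <= r.2 + eps].

Definition rate_region : set (R * R * R) := [set r | achievable r].

Variable W : finType.
Notation J := (W * X * Y * U * V)%type.

Definition rvW (t : J) : W := t.1.1.1.1.
Definition rvX (t : J) : X := t.1.1.1.2.
Definition rvY (t : J) : Y := t.1.1.2.
Definition rvU (t : J) : U := t.1.2.
Definition rvV (t : J) : V := t.2.
Definition rvXY (t : J) : X * Y := (rvX t, rvY t).

Definition in_P (p : J -> R) : Prop :=
  is_pmf p /\
  (exists k : W -> X -> Y -> R,
     (forall w x y, 0 <= k w x y) /\ (forall x y, \sum_w k w x y = 1) /\
     forall w x y u v, p ((((w, x), y), u), v) = k w x y * Q (((x, y), u), v)) /\
  (forall x y u v, \sum_w p ((((w, x), y), u), v) = Q (((x, y), u), v)).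

Definition Rin_p (p : J -> R) : set (R * R * R) :=
  [set r | [/\ Num.max (cond_mutinfo p rvXY rvW rvU) (cond_mutinfo p rvXY rvW rvV) <= r.1.1,
              cond_entropy p rvX (pairRV rvW rvU) <= r.1.2 &
              cond_entropy p rvY (pairRV rvW rvV) <= r.2]].

Definition Rin : set (R * R * R) :=
  @closure (R * R * R)%type (\bigcup_(p in in_P) Rin_p p).
End Problem.
End Defs.

(* Main.v *)
(* A Wyner-Ziv code with two receivers.  The encoder looks in a random codebook
   [w_1, ..., w_L] with i.i.d. letters of law [p_W] for a codeword jointly typical
   with [(x, y)], and sends the index of its random bin as [M_0]; the bin has about
   [L / |M_0|] codewords, few enough to be resolved by [U] and by [V] alone.
   [M_1] and [M_2] are random hashes of [x] and [y].

   The analysis is done for one block, over abstract finite alphabets.  Instead of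
   the Markov lemma, a codeword is accepted only if the conditional probability,
   given [(x, y)], that the side information spoils typicality is at most [tau]
   (Wyner's piggyback trick).  Given the codebook, the binning and the two hashes
   can be derandomized separately, and the codebook last.  Since
   [W - (X, Y) - (U, V)] is a Markov chain, [I(X,Y;W|U) = I(X,Y;W) - I(W;U)], which
   is the required rate of [M_0]. *)
Require Import Defs.
From HB Require Import structures.
From mathcomp Require Import all_boot all_order all_algebra.
From mathcomp Require Import ring lra.
From mathcomp Require Import all_classical all_reals.
From mathcomp Require Import topology normedtype sequences exp.
Import numFieldNormedType.Exports.
Import Order.TTheory GRing.Theory Num.Theory.
Local Open Scope ring_scope.
Local Open Scope classical_set_scope.
Set Implicit Arguments. Unset Strict Implicit. Unset Printing Implicit Defensive.

(** * Finite probability *)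

Section FiniteProbability.
Variable R : realType.

(** Basis of every derandomization below. If all values of [f] exceeded [c], the mean would too:
    equality would force [mu] to vanish. *)
Lemma exists_le_mean (T : finType) (mu f : T -> R) (c : R) :
  is_pmf mu -> \sum_t mu t * f t <= c -> exists t, f t <= c.
Proof.
move=> [mu0 mu1] le_c; apply/existsP; apply: contraPT le_c.
rewrite negb_exists => /forallP fc; apply/negP; rewrite -ltNge.
have fc' t : c < f t by rewrite ltNge.
rewrite -[c]mul1r -mu1 mulr_suml lt_neqAle; apply/andP; split; last first.
  by apply: ler_sum => t _; apply: ler_wpM2l => //; apply: ltW.
apply/eqP => /esym/eqP; rewrite -subr_eq0 -sumrB psumr_eq0; last first.
  by move=> t _; rewrite -mulrBr mulr_ge0 // subr_ge0 ltW.
move=> /allP z; have : \sum_t mu t = 0.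
  apply: big1 => t _; have := z t (mem_index_enum _); rewrite -mulrBr mulf_eq0.
  by rewrite subr_eq0 (gt_eqF (fc' t)) orbF => /eqP.
by rewrite mu1 => /eqP; rewrite oner_eq0.
Qed.

Lemma law_mean (T A : finType) (mu : T -> R) (f : T -> A) (phi : A -> R) :
  \sum_a law mu f a * phi a = \sum_t mu t * phi (f t).
Proof.
rewrite (partition_big f predT) //=; apply: eq_bigr => a _.
by rewrite mulr_suml; apply: eq_bigr => t /eqP ->.
Qed.

Lemma law_ge0 (T A : finType) (mu : T -> R) (f : T -> A) a :
  (forall t, 0 <= mu t) -> 0 <= law mu f a.
Proof. by move=> mu0; apply: sumr_ge0. Qed.

Lemma sum_law (T A : finType) (mu : T -> R) (f : T -> A) :
  \sum_a law mu f a = \sum_t mu t.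
Proof.
by rewrite -[RHS](eq_bigr _ (fun t _ => mulr1 _)) -(law_mean mu f (fun=> 1));
   apply: eq_bigr => a _; rewrite mulr1.
Qed.

Lemma law_ge (T A : finType) (mu : T -> R) (f : T -> A) t :
  (forall t, 0 <= mu t) -> mu t <= law mu f (f t).
Proof.
by move=> mu0; rewrite /law (bigD1 t) //= lerDl; apply: sumr_ge0.
Qed.

Section Product.
Variables (I T : finType) (mu : T -> R).
Hypothesis mu_pmf : is_pmf mu.

Definition prodm (s : {ffun I -> T}) : R := \prod_i mu (s i).

Lemma sum_ffun_prod (F : I -> T -> R) :
  \sum_(s : {ffun I -> T}) \prod_i F i (s i) = \prod_i \sum_t F i t.
Proof. by rewrite bigA_distr_bigA. Qed.

Lemma prodm_pmf : is_pmf prodm.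
Proof.
case: mu_pmf => mu0 mu1; split; first by move=> s; apply: prodr_ge0.
by rewrite (sum_ffun_prod (fun=> mu)) mu1 big1.
Qed.

Lemma prodm_mean1 (i : I) (phi : T -> R) :
  \sum_s prodm s * phi (s i) = \sum_t mu t * phi t.
Proof.
case: mu_pmf => mu0 mu1.
(* Putting [phi] at coordinate [i] and 1 elsewhere makes the summand a product over coordinates. *)
pose F k t := mu t * (if k == i then phi t else 1).
transitivity (\sum_(s : {ffun I -> T}) \prod_k F k (s k)).
  apply: eq_bigr => s _; rewrite big_split /=; congr (_ * _).
  by rewrite -big_mkcond big_pred1_eq.
rewrite sum_ffun_prod (bigD1 i) //= [X in _ * X]big1 ?mulr1.
  by apply: eq_bigr => t _; rewrite /F eqxx.
move=> k /negbTE ki; rewrite -[RHS]mu1; apply: eq_bigr => t _.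
by rewrite /F ki mulr1.
Qed.

Lemma prodm_mean2 (i j : I) (phi psi : T -> R) : i != j ->
  \sum_s prodm s * (phi (s i) * psi (s j)) =
  (\sum_t mu t * phi t) * (\sum_t mu t * psi t).
Proof.
case: mu_pmf => mu0 mu1 ij.
pose F k t := mu t * ((if k == i then phi t else 1) *
                      (if k == j then psi t else 1)).
transitivity (\sum_(s : {ffun I -> T}) \prod_k F k (s k)).
  apply: eq_bigr => s _; rewrite !big_split /=; congr (_ * (_ * _)).
    by rewrite -big_mkcond big_pred1_eq.
  by rewrite -big_mkcond big_pred1_eq.
rewrite sum_ffun_prod (bigD1 i) //= (bigD1 j) 1?eq_sym //=.
rewrite [X in _ * (_ * X)]big1 ?mulr1.
  congr (_ * _); apply: eq_bigr => t _; rewrite /F eqxx.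
    by rewrite (negbTE ij) mulr1.
  by rewrite eq_sym (negbTE ij) mul1r.
move=> k /andP[/negbTE ki /negbTE kj]; rewrite -[RHS]mu1.
by apply: eq_bigr => t _; rewrite /F ki kj !mulr1.
Qed.

End Product.

Lemma uniform_pmf m : is_pmf (fun _ : 'I_m.+1 => m.+1%:R^-1 : R).
Proof.
split=> [_|]; first by rewrite invr_ge0.
by rewrite sumr_const card_ord -[LHS]mulr_natl mulfV // pnatr_eq0.
Qed.

(** For uniform [h], two distinct points collide with probability [1 / m.+1]. The weight [d] lets
    one lemma serve both the binning of codewords and the hashes of the sources. *)
Lemma exists_hash (S T : finType) (m : nat) (t : S -> T) (d : S -> T -> R) :
  (forall s t', 0 <= d s t') ->
  exists h : {ffun T -> 'I_m.+1},
    \sum_s \sum_t' ((t' != t s) && (h t' == h (t s)))%:R * d s t'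
      <= (\sum_s \sum_t' d s t') / m.+1%:R.
Proof.
move=> d0; apply: (exists_le_mean (prodm_pmf T (uniform_pmf m))).
under eq_bigr => h _ do rewrite mulr_sumr.
rewrite exchange_big mulr_suml; apply: ler_sum => s _ /=.
under eq_bigr => h _ do rewrite mulr_sumr.
rewrite exchange_big mulr_suml; apply: ler_sum => t' _ /=.
under eq_bigr => h _ do rewrite mulrA.
rewrite -mulr_suml mulrC ler_wpM2l //.
have [_|neq] /= := eqVneq t' (t s).
  by rewrite big1 ?invr_ge0 // => h _; rewrite mulr0.
(* Splitting a collision by its common value gives products, to which pairwise independence
   applies. *)
have eqE (h : {ffun T -> 'I_m.+1}) :
    (h t' == h (t s))%:R = \sum_c (h t' == c)%:R * (h (t s) == c)%:R :> R.
  rewrite (bigD1 (h t')) //= eqxx mul1r eq_sym big1 ?addr0 // => c.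
  by rewrite eq_sym => /negbTE ->; rewrite mul0r.
under eq_bigr => h _ do rewrite eqE mulr_sumr.
rewrite exchange_big /=.
have one c : \sum_(x < m.+1) m.+1%:R^-1 * (x == c)%:R = m.+1%:R^-1 :> R.
  rewrite (bigD1 c) //= eqxx mulr1 big1 ?addr0 // => x /negbTE ->.
  by rewrite mulr0.
rewrite (eq_bigr (fun=> m.+1%:R^-1 * m.+1%:R^-1)); last first.
  move=> c _; pose phi (x : 'I_m.+1) : R := (x == c)%:R.
  by rewrite (prodm_mean2 (uniform_pmf m) phi phi neq) !one.
by rewrite sumr_const card_ord -[X in X <= _]mulr_natl mulVKf ?pnatr_eq0.
Qed.

(** One-sided Chebyshev inequality: independence and zero mean kill the cross terms of the second
    moment. *)
Lemma weak_lln (T : finType) (mu g : T -> R) (c : R) n :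
  is_pmf mu -> \sum_t mu t * g t = 0 -> 0 < c -> (0 < n)%N ->
  \sum_(s : {ffun 'I_n -> T}) prodm mu s * (n%:R * c < \sum_i g (s i))%R%:R
    <= (\sum_t mu t * g t ^+ 2) / (n%:R * c ^+ 2).
Proof.
move=> mu_pmf g0 c0 n0.
have nc0 : 0 < n%:R * c by rewrite mulr_gt0 // ltr0n.
have second : \sum_(s : {ffun 'I_n -> T}) prodm mu s * (\sum_i g (s i)) ^+ 2
    = n%:R * \sum_t mu t * g t ^+ 2.
  under eq_bigr => s _ do rewrite expr2 mulr_suml mulr_sumr.
  rewrite exchange_big /=.
  transitivity (\sum_(i < n) \sum_t mu t * g t ^+ 2); last first.
    by rewrite sumr_const card_ord mulr_natl.
  apply: eq_bigr => i _.
  under eq_bigr => s _ do rewrite mulr_sumr mulr_sumr.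
  rewrite exchange_big /= (bigD1 i) //= [X in _ + X]big1 ?addr0.
    under eq_bigr => s _ do rewrite -expr2.
    exact: (prodm_mean1 mu_pmf i (fun t => g t ^+ 2)).
  move=> j ji; rewrite (prodm_mean2 mu_pmf g g) 1?eq_sym //.
  by rewrite g0 mul0r.
have -> : (\sum_t mu t * g t ^+ 2) / (n%:R * c ^+ 2) =
    (n%:R * \sum_t mu t * g t ^+ 2) / (n%:R * c) ^+ 2.
  have n1 : n%:R != 0 :> R by rewrite pnatr_eq0 -lt0n.
  field; by rewrite n1 gt_eqF.
rewrite -second mulr_suml; apply: ler_sum => s _.
rewrite -mulrA ler_wpM2l //; first by case: (prodm_pmf 'I_n mu_pmf).
case: ltP => [lt|_]; last by rewrite mulr_ge0 ?invr_ge0 ?sqr_ge0.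
rewrite ler_pdivlMr ?exprn_gt0 // mul1r lerXn2r ?nnegrE ?ltW //.
exact: lt_trans lt.
Qed.

(** The logarithm of the product is a sum of i.i.d. terms, so the weak law applies. Upper deviations
    suffice because typicality is defined by upper bounds only. *)
Lemma aep (T : finType) (mu r : T -> R) (e delta : R) :
  is_pmf mu -> (forall t, 0 < mu t -> 0 < r t) -> 0 < e -> 0 < delta ->
  exists N, forall n, (N <= n)%N ->
  \sum_(s : {ffun 'I_n -> T}) prodm mu s *
     (expR (n%:R * (\sum_t mu t * ln (r t) + e)) < \prod_i r (s i))%R%:R
    <= delta.
Proof.
move=> mu_pmf r0 e0 d0; case: (mu_pmf) => mu0 mu1.
set D := \sum_t _; pose g t := ln (r t) - D.
have g0 : \sum_t mu t * g t = 0.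
  under eq_bigr => t _ do rewrite mulrBr.
  by rewrite sumrB -mulr_suml mu1 mul1r subrr.
set V := \sum_t mu t * g t ^+ 2.
exists (Num.truncn (V / (e ^+ 2 * delta))).+1 => n Nn.
have n0 : (0 < n)%N by apply: leq_trans Nn.
have n0R : 0 < n%:R :> R by rewrite ltr0n.
apply: (@le_trans _ _ (V / (n%:R * e ^+ 2))); last first.
  rewrite ler_pdivrMr ?mulr_gt0 ?exprn_gt0 //.
  have /ltW := truncnS_gt (V / (e ^+ 2 * delta)).
  rewrite ler_pdivrMr ?mulr_gt0 ?exprn_gt0 // => h; apply: (le_trans h).
  rewrite [X in _ <= X](_ : _ = n%:R * (e ^+ 2 * delta)); last by ring.
  by rewrite ler_wpM2r ?ler_nat ?mulr_ge0 ?sqr_ge0 // ltW.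
apply: le_trans (weak_lln mu_pmf g0 e0 n0).
apply: ler_sum => s _.
have p0 : 0 <= prodm mu s := (prodm_pmf 'I_n mu_pmf).1 s.
(* Positivity of [r] is known only on the support of [mu], so null sequences are set aside before
   taking logarithms. *)
have [ps0|ps0] := eqVneq (prodm mu s) 0; first by rewrite ps0 !mul0r.
apply: ler_wpM2l => //.
have rs i : 0 < r (s i).
  apply: r0; rewrite lt_neqAle mu0 andbT eq_sym; apply: contraNneq ps0 => z.
  by rewrite /prodm (bigD1 i) //= z mul0r.
have -> : \prod_i r (s i) = expR (\sum_i ln (r (s i))).
  by rewrite expR_sum; apply: eq_bigr => i _; rewrite lnK ?posrE.
rewrite ltr_expR /g sumrB sumr_const card_ord -[D *+ n]mulr_natl.
by rewrite ltrBrDl -mulrDr.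
Qed.

(* From [ln x <= x - 1] applied to [x = 1 / r t]. *)
Lemma gibbs (T : finType) (mu r : T -> R) :
  is_pmf mu -> (forall t, 0 < mu t -> 0 < r t) ->
  \sum_t mu t / r t <= 1 -> 0 <= \sum_t mu t * ln (r t).
Proof.
move=> [mu0 mu1] r0 le1.
apply: (@le_trans _ _ (\sum_t (mu t - mu t / r t))).
  by rewrite sumrB mu1 subr_ge0.
apply: ler_sum => t _; have [->|mut] := eqVneq (mu t) 0.
  by rewrite !mul0r subrr.
have rt : 0 < r t by apply: r0; rewrite lt_neqAle eq_sym mut mu0.
rewrite -{1}[mu t]mulr1 -mulrBr ler_wpM2l //.
have := @le_ln1Dx R ((r t)^-1 - 1).
rewrite [1 + _]addrC subrK lnV ?posrE // lerNl opprB; apply.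
by rewrite ltrBrDl subrr invr_gt0.
Qed.

End FiniteProbability.

(** * One-shot code *)

Section OneShot.
Variable R : realType.

(** Bounds the chance that [n] independent draws all miss by [1 / (1 + n P)], without division. The
    induction rests on [(1 - P) (1 + (n + 1) P) <= 1 + n P]. *)
Lemma bernoulli_mul_le1 (P : R) n : 0 <= P <= 1 ->
  (1 - P) ^+ n * (1 + n%:R * P) <= 1.
Proof.
move=> /andP[P0 P1]; elim: n => [|n ih]; first by rewrite mul0r addr0 mulr1.
apply: le_trans ih; rewrite exprSr -mulrA ler_wpM2l ?exprn_ge0 ?subr_ge0 //.
rewrite -natr1 -subr_ge0.
have n0 : 0 <= n%:R :> R by [].
rewrite (_ : _ - _ = (n%:R + 1) * P ^+ 2); last by ring.
by rewrite mulr_ge0 ?sqr_ge0 // addr_ge0.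
Qed.

Section Decoder.
Variables (X U W I B0 B1 : finType) (x0 : X) (C : I -> W) (b : I -> B0)
  (c : X -> B1) (T : W -> U -> bool) (D : W -> U -> X -> bool).

(** Joint search for a codeword index and a source word. Uniqueness is not tested: the error bound
    counts every false candidate. *)
Definition bin_dec (b0 : B0) (c0 : B1) (u : U) : X :=
  odflt x0 (omap snd [pick lx : I * X |
    [&& b lx.1 == b0, T (C lx.1) u, c lx.2 == c0 & D (C lx.1) u lx.2]]).

(** The true pair passes, so the search succeeds. A wrong output comes with a false codeword of the
    same bin passing [T], or with the true codeword and a false source word of the same hash passing
    [D]. *)
Lemma bin_dec_error l x u : T (C l) u -> D (C l) u x ->
  (bin_dec (b l) (c x) u != x)%:R <=
  \sum_l' ((l' != l) && (b l' == b l))%:R * (T (C l') u)%:R +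
  \sum_x' ((x' != x) && (c x' == c x))%:R * (D (C l) u x')%:R :> R.
Proof.
move=> Tl Dx; rewrite /bin_dec.
case: pickP => [[l' x'] /= /and4P[bl Tl' cx Dx']|/(_ (l, x))]; last first.
  by rewrite /= !eqxx Tl Dx.
have [_|neqx] := eqVneq x' x.
  by rewrite addr_ge0 // sumr_ge0 // => i _; rewrite mulr_ge0.
have [ll'|neql] := eqVneq l' l.
  rewrite [X in _ <= _ + X](bigD1 x') //= neqx cx /= -ll' Dx' mulr1 addrCA.
  rewrite lerDl addr_ge0 // sumr_ge0 // => i _; by rewrite mulr_ge0.
rewrite (bigD1 l') //= neql bl /= Tl' mulr1 -addrA.
rewrite lerDl addr_ge0 // sumr_ge0 // => i _; by rewrite mulr_ge0.
Qed.

End Decoder.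

Variables (S X Y U V W : finType) (q : S -> R).
Variables (rx : S -> X) (ry : S -> Y) (ru : S -> U) (rv : S -> V).
Variables (k : W -> X * Y -> R) (pW : W -> R) (G : W -> S -> bool).
Variables (TU : W -> U -> bool) (TV : W -> V -> bool).
Variables (DX : W -> U -> X -> bool) (DY : W -> V -> Y -> bool).
Variables (a betaU betaV NX NY tau : R).

Let rxy s := (rx s, ry s).

(** [G] abstracts joint typicality of a codeword with the whole source. For blocks, up to [e] in the
    exponent rates, [a] is the exponential of [n I(X,Y;W)], [betaU] that of [- n I(W;U)] and [NX]
    that of [n H(X|W,U)]. *)
Hypotheses (q_pmf : is_pmf q) (pW_pmf : is_pmf pW).
Hypotheses (k_ge0 : forall w z, 0 <= k w z) (k_sum : forall z, \sum_w k w z = 1).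
Hypotheses (a_gt0 : 0 < a) (tau_gt0 : 0 < tau).
Hypothesis G_cover : forall w s, G w s -> k w (rxy s) <= a * pW w.
Hypothesis G_TU : forall w s, G w s -> TU w (ru s).
Hypothesis G_TV : forall w s, G w s -> TV w (rv s).
Hypothesis G_DX : forall w s, G w s -> DX w (ru s) (rx s).
Hypothesis G_DY : forall w s, G w s -> DY w (rv s) (ry s).
Hypothesis G_prob :
  \sum_s q s * (\sum_w k w (rxy s) * (~~ G w s)%:R) <= tau ^+ 2.
Hypothesis TU_prob : \sum_s q s * (\sum_w pW w * (TU w (ru s))%:R) <= betaU.
Hypothesis TV_prob : \sum_s q s * (\sum_w pW w * (TV w (rv s))%:R) <= betaV.
Hypothesis DX_card : forall w u, \sum_x (DX w u x)%:R <= NX.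
Hypothesis DY_card : forall w v, \sum_y (DY w v y)%:R <= NY.

(* The second condition replaces the Markov lemma. *)
Definition admissible (w : W) (z : X * Y) : bool :=
  (k w z <= a * pW w) &&
  (law (fun s => q s * (~~ G w s)%:R) rxy z <= tau * law q rxy z).

Let q_ge0 s : 0 <= q s. Proof. by case: q_pmf. Qed.
Let pW_ge0 w : 0 <= pW w. Proof. by case: pW_pmf. Qed.

(** Where [G] holds the first condition is automatic, so only the second can fail. Markov's
    inequality handles it: a conditional probability of mean at most [tau ^+ 2] exceeds [tau] with
    probability at most [tau]. *)
Lemma inadmissible_prob :
  \sum_s q s * (\sum_w k w (rxy s) * (~~ admissible w (rxy s))%:R)
    <= tau + tau ^+ 2.
Proof.
(* Left unnormalized, to avoid dividing by a possibly null probability of [z]. *)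
pose bad w z := law (fun s => q s * (~~ G w s)%:R) rxy z.
apply: (@le_trans _ _
  (\sum_z law q rxy z * (\sum_w k w z * (tau * law q rxy z < bad w z)%R%:R) +
   \sum_s q s * (\sum_w k w (rxy s) * (~~ G w s)%:R))).
  rewrite (law_mean q rxy) -big_split; apply: ler_sum => s _ /=.
  rewrite -mulrDr ler_wpM2l // -big_split; apply: ler_sum => w _ /=.
  rewrite -mulrDr ler_wpM2l // /admissible negb_and -!ltNge.
  case Gs: (G w s); last by rewrite ler_wpDl ?lern1 ?leq_b1.
  by rewrite ltNge (G_cover Gs) /= addr0.
apply: lerD => //.
rewrite -(ler_pM2r tau_gt0) -[X in _ <= X]expr2 mulr_suml; apply: le_trans G_prob.
have -> : \sum_s q s * (\sum_w k w (rxy s) * (~~ G w s)%:R) =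
    \sum_z \sum_w k w z * bad w z.
  rewrite (partition_big rxy predT) //=; apply: eq_bigr => z _.
  under [RHS]eq_bigr => w _ do rewrite mulr_sumr.
  rewrite exchange_big /=; apply: eq_bigr => s /eqP sz; rewrite mulr_sumr.
  by apply: eq_bigr => w _; rewrite sz mulrCA.
apply: ler_sum => z _; rewrite mulr_sumr mulr_suml; apply: ler_sum => w _.
rewrite mulrCA -mulrA ler_wpM2l //.
case: ltP => [/ltW|_]; first by rewrite mulr1 mulrC.
by rewrite mulr0 mul0r sumr_ge0 // => s _; rewrite mulr_ge0.
Qed.

Section Codebook.
Variable L : nat.

Definition covered (C : {ffun 'I_L.+1 -> W}) z := [exists l, admissible (C l) z].

Definition select (C : {ffun 'I_L.+1 -> W}) z : 'I_L.+1 :=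
  odflt ord0 [pick l | admissible (C l) z].

Lemma admissible_select C z : covered C z -> admissible (C (select C z)) z.
Proof.
move=> /existsP[l Fl]; rewrite /select; case: pickP => // /(_ l).
by rewrite Fl.
Qed.

(** Covering by independent draws: all miss with probability [(1 - P) ^+ L.+1]. Admissible words
    satisfy [k <= a * pW], so [P] is at least [p / a], where [p] is the probability of admissibility
    under the kernel. *)
Lemma cover_prob z :
  \sum_C prodm pW C * (~~ covered C z)%:R <=
  \sum_w k w z * (~~ admissible w z)%:R + a / L.+1%:R.
Proof.
set P := \sum_w pW w * (admissible w z)%:R.
set p := \sum_w k w z * (admissible w z)%:R.
have [_ pW1] := pW_pmf.
have sumC (f : W -> R) : \sum_w f w = 1 ->
    \sum_w f w * (~~ admissible w z)%:R =
    1 - \sum_w f w * (admissible w z)%:R.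
  move=> f1; apply/eqP; rewrite -[X in X - _]f1 eq_sym subr_eq -big_split /=; apply/eqP.
  apply: eq_bigr => w _; rewrite -mulrDr.
  by case: (admissible w z); rewrite /= ?addr0 ?add0r mulr1.
rewrite (sumC (fun w => k w z)) // -/p.
have -> : \sum_(C : {ffun 'I_L.+1 -> W}) prodm pW C * (~~ covered C z)%:R
    = (1 - P) ^+ L.+1.
  rewrite -(sumC pW) // -[in RHS](card_ord L.+1) -prodr_const.
  rewrite -(sum_ffun_prod (fun (_ : 'I_L.+1) w => pW w * (~~ admissible w z)%:R)).
  apply: eq_bigr => C _; rewrite big_split /=; congr (_ * _).
  rewrite /covered negb_exists; case: forallP => [h|h].
    by rewrite big1 // => l _; rewrite h.
  suff /existsP[l Fl] : [exists l, admissible (C l) z].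
    by rewrite (bigD1 l) //= Fl mul0r.
  by apply: contraT; rewrite negb_exists => /forallP.
have P01 : 0 <= P <= 1.
  rewrite sumr_ge0 /= => [|w _]; last by rewrite mulr_ge0.
  rewrite -pW1; apply: ler_sum => w _.
  by case: (admissible w z); rewrite ?mulr1 ?mulr0.
have p0 : 0 <= p by apply: sumr_ge0 => w _; rewrite mulr_ge0.
have p1 : p <= 1.
  rewrite -(k_sum z); apply: ler_sum => w _.
  by case: (admissible w z); rewrite ?mulr1 ?mulr0.
have pP : p / a <= P.
  rewrite ler_pdivrMr // mulrC mulr_sumr; apply: ler_sum => w _.
  case Fw: (admissible w z); last by rewrite !mulr0.
  by rewrite !mulr1; case/andP: Fw.
have := bernoulli_mul_le1 L.+1 P01.
set K := L.+1%:R; set A := _ ^+ _ => AP.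
have K0 : 0 < K by rewrite /K ltr0n.
have A0 : 0 <= A by rewrite exprn_ge0 // subr_ge0; case/andP: P01.
have {}AP : A * (1 + K / a * p) <= 1.
  apply: le_trans AP; rewrite ler_wpM2l // lerD2l.
  by rewrite mulrAC -mulrA ler_wpM2l // ltW.
rewrite -[a / K]invf_div; set J := K / a in AP *.
have J0 : 0 < J by rewrite divr_gt0.
have Jp : 0 < 1 + J * p by rewrite ltr_wpDr // mulr_ge0 // ltW.
rewrite -(ler_pM2r Jp); apply: (le_trans AP).
(* This identity shows [1 / (1 + J p) <= 1 - p + 1 / J] for [p] in the unit interval. *)
have -> : (1 - p + J^-1) * (1 + J * p) = 1 + (J^-1 + J * (p * (1 - p))).
  by field; rewrite gt_eqF.
have q0 : 0 <= p * (1 - p) by rewrite mulr_ge0 // subr_ge0.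
by rewrite lerDl addr_ge0 // ?invr_ge0 ?(mulr_ge0 _ q0) // ltW.
Qed.

(** The selected word depends on [s] only through [rxy s], so the second admissibility condition can
    be summed over [z], whatever the codebook. *)
Lemma select_bad_prob C :
  \sum_s q s * (covered C (rxy s) && ~~ G (C (select C (rxy s))) s)%:R <= tau.
Proof.
have [_ q1] := q_pmf.
rewrite (_ : tau = \sum_z tau * law q rxy z); last first.
  by rewrite -mulr_sumr sum_law q1 mulr1.
rewrite (partition_big rxy predT) //=; apply: ler_sum => z _.
case cz: (covered C z); last first.
  rewrite big1 ?mulr_ge0 ?law_ge0 ?ltW // => s /eqP ->.
  by rewrite cz mulr0.
have /andP[_ h] := admissible_select cz; apply: le_trans h; rewrite /law.
by apply: ler_sum => s /eqP ->; rewrite cz.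
Qed.

(** Union bound: no admissible codeword, a selected codeword outside [G], or a false candidate.
    Abstract [fa] and [fb] let it serve both receivers. *)
Lemma decoding_error (A B : finType) (fa : S -> A) (fb : S -> B)
    (T : W -> B -> bool) (D : W -> B -> A -> bool) (x0 : A) m0 m1
    (C : {ffun 'I_L.+1 -> W}) (b : {ffun 'I_L.+1 -> 'I_m0})
    (c : {ffun A -> 'I_m1}) :
  (forall w s, G w s -> T w (fb s)) ->
  (forall w s, G w s -> D w (fb s) (fa s)) ->
  \sum_s q s *
    (bin_dec x0 C b c T D (b (select C (rxy s))) (c (fa s)) (fb s) != fa s)%:R
  <= \sum_s q s * (~~ covered C (rxy s))%:R + tau +
     (\sum_s \sum_l ((l != select C (rxy s)) && (b l == b (select C (rxy s))))%:R
                    * (q s * (T (C l) (fb s))%:R) +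
      \sum_s \sum_x ((x != fa s) && (c x == c (fa s)))%:R
                    * (q s * (D (C (select C (rxy s))) (fb s) x)%:R)).
Proof.
move=> G_T G_D.
apply: le_trans (lerD (lerD (lexx _) (select_bad_prob C)) (lexx _)).
rewrite -!big_split; apply: ler_sum => s _ /=.
under [X in _ <= _ + (X + _)]eq_bigr => l _ do rewrite mulrCA.
under [X in _ <= _ + (_ + X)]eq_bigr => x _ do rewrite mulrCA.
rewrite -!mulr_sumr -!mulrDr ler_wpM2l //.
set E1 := \sum_i _; set E2 := \sum_i _.
have E0 : 0 <= E1 + E2.
  by rewrite addr_ge0 // sumr_ge0 // => i _; rewrite mulr_ge0.
case cs: (covered C (rxy s)); last first.
  by rewrite /= addr0 ler_wpDr ?lern1 ?leq_b1.
case Gs: (G _ s); last by rewrite /= add0r ler_wpDr ?lern1 ?leq_b1.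
by rewrite /= !add0r; apply: bin_dec_error; [exact: G_T|exact: G_D].
Qed.

End Codebook.

(** Bounding the sum of the two error probabilities lets a single codebook and a single binning
    serve both receivers. *)
Lemma one_shot_code (L m0 m1 m2 : nat) :
  exists (e0 : X -> Y -> 'I_m0.+1) (e1 : X -> 'I_m1.+1) (e2 : Y -> 'I_m2.+1)
    (dx : 'I_m0.+1 -> 'I_m1.+1 -> U -> X) (dy : 'I_m0.+1 -> 'I_m2.+1 -> V -> Y),
  \sum_s q s * (dx (e0 (rx s) (ry s)) (e1 (rx s)) (ru s) != rx s)%:R +
  \sum_s q s * (dy (e0 (rx s) (ry s)) (e2 (ry s)) (rv s) != ry s)%:R <=
  (tau + tau ^+ 2 + a / L.+1%:R + tau) *+ 2 +
  L.+1%:R * (betaU + betaV) / m0.+1%:R + NX / m1.+1%:R + NY / m2.+1%:R.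
Proof.
have [_ q1] := q_pmf.
(* A point of [S] supplies the default outputs of the decoders. *)
have [s0 _] : exists s : S, true.
  apply/existsP; apply: contraT; rewrite negb_exists => /forallP h.
  by move: (oner_eq0 R); rewrite -q1 big1 ?eqxx // => s; have := h s.
have avg (c : R) : c = \sum_s q s * c by rewrite -mulr_suml q1 mul1r.
pose hit (C : {ffun 'I_L.+1 -> W}) l s : R :=
  (TU (C l) (ru s))%:R + (TV (C l) (rv s))%:R.
(* The part of the bound that depends on the codebook, with the binning already averaged. Summing
   over all [l], including the selected one, avoids conditioning on the selection: each [C l] has
   law [pW]. *)
pose total (C : {ffun 'I_L.+1 -> W}) : R :=
  (\sum_s q s * (~~ covered C (rxy s))%:R) *+ 2 +
  (\sum_s \sum_l q s * hit C l s) / m0.+1%:R.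
have meanC : \sum_C prodm pW C * total C <=
    (tau + tau ^+ 2 + a / L.+1%:R) *+ 2 + L.+1%:R * (betaU + betaV) / m0.+1%:R.
  under eq_bigr => C _ do rewrite mulrDr mulrnAr mulrA.
  rewrite big_split /= sumrMnl -mulr_suml; apply: lerD.
    rewrite lerMn2r /=.
    under eq_bigr => C _ do rewrite mulr_sumr.
    rewrite exchange_big /=.
    apply: le_trans (lerD inadmissible_prob (lexx (a / L.+1%:R))).
    rewrite [a / _]avg -big_split; apply: ler_sum => s _ /=.
    rewrite -mulrDr; apply: le_trans (ler_wpM2l (q_ge0 s) (cover_prob L (rxy s))).
    by rewrite mulr_sumr; apply: ler_sum => C _; rewrite mulrCA.
  rewrite ler_wpM2r ?invr_ge0 //.
  under eq_bigr => C _ do rewrite mulr_sumr.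
  rewrite exchange_big /=.
  apply: (@le_trans _ _ (L.+1%:R *
    (\sum_s q s * (\sum_w pW w * (TU w (ru s))%:R) +
     \sum_s q s * (\sum_w pW w * (TV w (rv s))%:R)))); last first.
    by rewrite ler_wpM2l // lerD.
  rewrite -big_split mulr_sumr; apply: ler_sum => s _ /=.
  under eq_bigr => C _ do rewrite -mulr_sumr mulrCA mulr_sumr.
  rewrite -mulr_sumr -mulrDr mulrCA ler_wpM2l // exchange_big /=.
  rewrite mulr_natl -[in X in _ <= X](card_ord L.+1) -sumr_const.
  apply: ler_sum => l _; rewrite -big_split /=.
  rewrite (prodm_mean1 pW_pmf l (fun w => (TU w (ru s))%:R + (TV w (rv s))%:R)).
  by apply: ler_sum => w _; rewrite mulrDr.
have [C leC] := exists_le_mean (prodm_pmf 'I_L.+1 pW_pmf) meanC.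
pose sel s := select C (rxy s).
have [b leb] := @exists_hash R S 'I_L.+1 m0 sel (fun s l => q s * hit C l s)
  (fun s l => mulr_ge0 (q_ge0 s) (addr_ge0 (ler0n _ _) (ler0n _ _))).
have [c1 le1] := @exists_hash R S X m1 rx
  (fun s x => q s * (DX (C (sel s)) (ru s) x)%:R)
  (fun s x => mulr_ge0 (q_ge0 s) (ler0n _ _)).
have [c2 le2] := @exists_hash R S Y m2 ry
  (fun s y => q s * (DY (C (sel s)) (rv s) y)%:R)
  (fun s y => mulr_ge0 (q_ge0 s) (ler0n _ _)).
exists (fun x y => b (select C (x, y))), c1, c2,
  (bin_dec (rx s0) C b c1 TU DX), (bin_dec (ry s0) C b c2 TV DY).
have errX := decoding_error (rx s0) C b c1 G_TU G_DX.
have errY := decoding_error (ry s0) C b c2 G_TV G_DY.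
apply: (le_trans (lerD errX errY)).
have N1 : (\sum_s \sum_x q s * (DX (C (sel s)) (ru s) x)%:R) / m1.+1%:R
    <= NX / m1.+1%:R.
  rewrite ler_wpM2r ?invr_ge0 // [NX]avg; apply: ler_sum => s _.
  by rewrite -mulr_sumr ler_wpM2l.
have N2 : (\sum_s \sum_y q s * (DY (C (sel s)) (rv s) y)%:R) / m2.+1%:R
    <= NY / m2.+1%:R.
  rewrite ler_wpM2r ?invr_ge0 // [NY]avg; apply: ler_sum => s _.
  by rewrite -mulr_sumr ler_wpM2l.
have {}le1 := le_trans le1 N1; have {}le2 := le_trans le2 N2.
have hitE : \sum_s \sum_t' ((t' != sel s) && (b t' == b (sel s)))%:R *
      (q s * hit C t' s) =
    \sum_s \sum_l ((l != sel s) && (b l == b (sel s)))%:R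
                    * (q s * (TU (C l) (ru s))%:R) +
    \sum_s \sum_l ((l != sel s) && (b l == b (sel s)))%:R
                    * (q s * (TV (C l) (rv s))%:R).
  rewrite -big_split; apply: eq_bigr => s _; rewrite -big_split /=.
  by apply: eq_bigr => l _; rewrite -!mulrDr.
rewrite {}hitE in leb; rewrite /total in leC.
have regroup (c t u1 v1 u2 v2 : R) :
  c + t + (u1 + u2) + (c + t + (v1 + v2)) = c *+ 2 + t *+ 2 + (u1 + v1) + u2 + v2.
  by ring.
rewrite regroup; apply: le_trans (lerD (lerD (lerD (lexx _) leb) le1) le2) _.
rewrite !lerD2r addrAC mulrnDl [X in _ <= X]addrAC lerD2r.
exact: leC.
Qed.

End OneShot.

(** * Single-letter information quantities *)

Section SingleLetter.
Variable R : realType.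

Lemma sum_law_pair (T A B : finType) (mu : T -> R) (f : T -> A) (g : T -> B) b :
  \sum_a law mu (pairRV f g) (a, b) = law mu g b.
Proof.
rewrite /law [RHS](partition_big f predT) //=; apply: eq_bigr => a _.
by apply: eq_bigl => t; rewrite xpair_eqE andbC.
Qed.

Lemma law_gt0 (T A : finType) (mu : T -> R) (f : T -> A) t :
  (forall t, 0 <= mu t) -> 0 < mu t -> 0 < law mu f (f t).
Proof. by move=> mu0 /lt_le_trans; apply; apply: law_ge. Qed.

Lemma ln2_gt0 : 0 < ln 2 :> R. Proof. by rewrite ln_gt0 // ltr1n. Qed.

(** Equality except at [y = 0], where division by zero gives 0. Hence the mass bounds below are
    inequalities. *)
Lemma mul_div_le (x y : R) : 0 <= x -> y * (x / y) <= x.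
Proof.
move=> x0; have [->|y0] := eqVneq y 0; first by rewrite mul0r.
by rewrite mulrC mulfVK.
Qed.

Variables (S W A : finType) (q : S -> R) (ra : S -> A) (k : W -> A -> R).
Hypotheses (q_pmf : is_pmf q).
Hypotheses (k_ge0 : forall w z, 0 <= k w z) (k_sum : forall z, \sum_w k w z = 1).

(** The kernel sees [s] only through [ra s], which encodes the Markov chain [W - ra(S) - S]. *)
Definition joint (t : W * S) : R := k t.1 (ra t.2) * q t.2.

Let q_ge0 s : 0 <= q s. Proof. by case: q_pmf. Qed.

Lemma joint_ge0 t : 0 <= joint t. Proof. exact: mulr_ge0. Qed.

Lemma joint_mean (phi : W -> S -> R) :
  \sum_t joint t * phi t.1 t.2 = \sum_s q s * (\sum_w k w (ra s) * phi w s).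
Proof.
rewrite -(pair_big predT predT
  (fun w s => joint (w, s) * phi w s)) /= exchange_big /=.
apply: eq_bigr => s _; rewrite mulr_sumr; apply: eq_bigr => w _.
by rewrite /joint /= mulrA [q s * _]mulrC.
Qed.

Lemma joint_mean_snd (phi : S -> R) :
  \sum_t joint t * phi t.2 = \sum_s q s * phi s.
Proof.
rewrite (joint_mean (fun _ => phi)); apply: eq_bigr => s _.
by rewrite -mulr_suml k_sum mul1r.
Qed.

Lemma joint_pmf : is_pmf joint.
Proof.
case: q_pmf => _ q1; split; first exact: joint_ge0.
under eq_bigr => t _ do rewrite -[joint t]mulr1.
rewrite (joint_mean_snd (fun=> 1)) -[RHS]q1.
by apply: eq_bigr => s _; rewrite mulr1.
Qed.

Lemma lawE (T B : finType) (mu : T -> R) (f : T -> B) b :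
  law mu f b = \sum_t mu t * (f t == b)%:R.
Proof. by rewrite /law big_mkcond; apply: eq_bigr => t _; rewrite mulr_natr mulrb. Qed.

Lemma law_joint_snd (B : finType) (g : S -> B) b :
  law joint (g \o snd) b = law q g b.
Proof. by rewrite !lawE (joint_mean_snd (fun s => (g s == b)%:R)). Qed.

Lemma law_joint_markov (B : finType) (g : S -> B) a w b :
  law joint (pairRV (pairRV (ra \o snd) fst) (g \o snd)) ((a, w), b) =
  k w a * law joint (pairRV (ra \o snd) (g \o snd)) (a, b).
Proof.
rewrite -[pairRV (ra \o snd) (g \o snd)]/((pairRV ra g) \o snd) law_joint_snd !lawE.
rewrite (joint_mean (fun w' s => (((ra s, w'), g s) == ((a, w), b))%:R)).
rewrite mulr_sumr; apply: eq_bigr => s _; rewrite mulrCA; congr (_ * _).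
rewrite (bigD1 w) //= big1 ?addr0 => [|w' /negbTE w'w]; rewrite /pairRV !xpair_eqE.
  by rewrite eqxx andbT; case: eqP => [->|_]; rewrite ?mulr0.
by rewrite w'w andbF mulr0.
Qed.

Definition pW := law joint fst.
Definition pWB (B : finType) (g : S -> B) w b :=
  law joint (pairRV fst (g \o snd)) (w, b).

Lemma pW_pmf : is_pmf pW.
Proof.
split; first by move=> w; apply: law_ge0; apply: joint_ge0.
by rewrite /pW sum_law; case: joint_pmf.
Qed.

(** Likelihood ratio [p(w|a) / p(w)]; its mean logarithm is the mutual information of [W] and [ra]
    in nats. *)
Definition cover_ratio (t : W * S) := k t.1 (ra t.2) / pW t.1.

Definition side_ratio (B : finType) (g : S -> B) w b :=
  pWB g w b / (pW w * law q g b).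

Definition cond_prob (C B : finType) (f : S -> C) (g : S -> B) w b c :=
  law joint (pairRV (f \o snd) (pairRV fst (g \o snd))) (c, (w, b)) / pWB g w b.

Section Positivity.
Variable t : W * S.
Hypothesis t_gt0 : 0 < joint t.

Lemma k_gt0 : 0 < k t.1 (ra t.2).
Proof.
rewrite lt_neqAle k_ge0 andbT eq_sym; apply: contraTneq t_gt0 => h.
by rewrite /joint h mul0r ltxx.
Qed.

Lemma pW_gt0 : 0 < pW t.1.
Proof. exact: (law_gt0 fst joint_ge0 t_gt0). Qed.

Lemma law_side_gt0 (B : finType) (g : S -> B) : 0 < law q g (g t.2).
Proof. by rewrite -law_joint_snd; exact: (law_gt0 (g \o snd) joint_ge0 t_gt0). Qed.

Lemma pWB_gt0 (B : finType) (g : S -> B) : 0 < pWB g t.1 (g t.2).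
Proof. exact: (law_gt0 (pairRV fst (g \o snd)) joint_ge0 t_gt0). Qed.

Lemma cover_ratio_gt0 : 0 < cover_ratio t.
Proof. by rewrite divr_gt0 ?k_gt0 ?pW_gt0. Qed.

Lemma side_ratio_gt0 (B : finType) (g : S -> B) : 0 < side_ratio g t.1 (g t.2).
Proof. by rewrite divr_gt0 ?mulr_gt0 ?pWB_gt0 ?pW_gt0 ?law_side_gt0. Qed.

Lemma cond_prob_gt0 (C B : finType) (f : S -> C) (g : S -> B) :
  0 < cond_prob f g t.1 (g t.2) (f t.2).
Proof.
rewrite divr_gt0 ?pWB_gt0 //.
exact: (law_gt0 (pairRV (f \o snd) (pairRV fst (g \o snd))) joint_ge0 t_gt0).
Qed.

End Positivity.

(** A likelihood ratio integrated against the product of the marginals returns the mass of the joint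
    law. This makes an independent codeword unlikely to pass the side information test. *)
Lemma side_ratio_mass (B : finType) (g : S -> B) :
  \sum_s q s * (\sum_w pW w * side_ratio g w (g s)) <= 1.
Proof.
rewrite -(law_mean q g (fun b => \sum_w pW w * side_ratio g w b)).
have [_ <-] := joint_pmf; rewrite -(sum_law joint (pairRV fst (g \o snd))).
rewrite -(pair_big predT predT (fun w b => pWB g w b)) /= exchange_big /=.
apply: ler_sum => b _; rewrite mulr_sumr; apply: ler_sum => w _.
rewrite mulrA [_ * pW w]mulrC; apply: mul_div_le.
exact: (law_ge0 _ _ joint_ge0).
Qed.

Lemma side_ratio_ge0 (B : finType) (g : S -> B) w b : 0 <= side_ratio g w b.
Proof.
by rewrite divr_ge0 ?mulr_ge0 // ?(law_ge0 _ _ joint_ge0) ?(law_ge0 _ _ q_ge0).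
Qed.

Lemma cond_prob_ge0 (C B : finType) (f : S -> C) (g : S -> B) w b c :
  0 <= cond_prob f g w b c.
Proof. by rewrite divr_ge0 ?(law_ge0 _ _ joint_ge0). Qed.

Lemma cond_prob_mass (C B : finType) (f : S -> C) (g : S -> B) w b :
  \sum_c cond_prob f g w b c <= 1.
Proof.
rewrite /cond_prob -mulr_suml sum_law_pair -/(pWB g w b).
have [->|h] := eqVneq (pWB g w b) 0; first by rewrite mul0r.
by rewrite mulfV.
Qed.

(** By the Markov property the conditional density factors as [cover_ratio] over [side_ratio],
    giving [I(A;W|B) = I(A;W) - I(W;B)]. The factor [ln 2] converts bits to nats. *)
Lemma cond_mutinfoE (B : finType) (g : S -> B) :
  cond_mutinfo joint (ra \o snd) fst (g \o snd) * ln 2 =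
  \sum_t joint t * ln (cover_ratio t) +
  \sum_t joint t * ln (side_ratio g t.1 (g t.2))^-1.
Proof.
rewrite /cond_mutinfo.
transitivity (\sum_t joint t * ln (
    law joint (pairRV (pairRV (ra \o snd) fst) (g \o snd)) ((ra t.2, t.1), g t.2)
    * law joint (g \o snd) (g t.2) /
    (law joint (pairRV (ra \o snd) (g \o snd)) (ra t.2, g t.2) *
     pWB g t.1 (g t.2)))).
  rewrite -(law_mean joint (pairRV (pairRV (ra \o snd) fst) (g \o snd))
    (fun z => ln (law joint (pairRV (pairRV (ra \o snd) fst) (g \o snd)) z
      * law joint (g \o snd) z.2 /
      (law joint (pairRV (ra \o snd) (g \o snd)) (z.1.1, z.2) *
       pWB g z.1.2 z.2)))).
  rewrite pair_big pair_big /= mulr_suml; apply: eq_bigr => -[[a w] b] _ /=.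
  by rewrite /log2 mulrA mulfVK // gt_eqF // ln2_gt0.
rewrite -big_split; apply: eq_bigr => t _ /=; rewrite -mulrDr.
have [->|tn0] := eqVneq (joint t) 0; first by rewrite !mul0r.
have t0 : 0 < joint t by rewrite lt_neqAle eq_sym tn0 joint_ge0.
congr (_ * _); rewrite -lnM ?posrE ?invr_gt0 ?cover_ratio_gt0 ?side_ratio_gt0 //.
congr ln; rewrite law_joint_markov law_joint_snd /cover_ratio /side_ratio.
have := law_gt0 (pairRV (ra \o snd) (g \o snd)) joint_ge0 t0.
rewrite /= -/(pairRV _ _ t) => h1; have h2 := pWB_gt0 t0 g; have h3 := pW_gt0 t0.
have h4 := law_side_gt0 t0 g.
by field; rewrite !gt_eqF.
Qed.

Lemma cond_entropyE (C B : finType) (f : S -> C) (g : S -> B) :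
  cond_entropy joint (f \o snd) (pairRV fst (g \o snd)) * ln 2 =
  \sum_t joint t * ln (cond_prob f g t.1 (g t.2) (f t.2))^-1.
Proof.
(* Includes [x = 0], where both the inverse and the logarithm are 0 by convention. *)
have lnV0 (x : R) : 0 <= x -> ln x^-1 = - ln x.
  rewrite le_eqVlt => /orP[/eqP <-|x0]; last by rewrite lnV.
  by rewrite invr0 ln0 // oppr0.
rewrite /cond_entropy pair_big /= mulNr mulr_suml -sumrN.
transitivity (\sum_z law joint (pairRV (f \o snd) (pairRV fst (g \o snd))) z
    * ln (cond_prob f g z.2.1 z.2.2 z.1)^-1); last by rewrite law_mean.
apply: eq_bigr => -[c [w b]] _ /=; rewrite lnV0 ?cond_prob_ge0 // mulrN.
by rewrite /log2 mulrA mulfVK // gt_eqF // ln2_gt0.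
Qed.

(** Gibbs' inequality, since the inverse ratio turns the kernel back into [pW]. Used to bound the
    rounding of the codebook size. *)
Lemma cover_info_ge0 : 0 <= \sum_t joint t * ln (cover_ratio t).
Proof.
apply: gibbs; [exact: joint_pmf|exact: cover_ratio_gt0|].
have [_ pW1] := pW_pmf; have [_ q1] := q_pmf.
rewrite -[X in _ <= X]q1.
rewrite (joint_mean (fun w s => (cover_ratio (w, s))^-1)); apply: ler_sum => s _.
rewrite -[X in _ <= X]mulr1 ler_wpM2l // -[X in _ <= X]pW1; apply: ler_sum => w _.
by rewrite invf_div mul_div_le //; case: pW_pmf.
Qed.

Lemma cond_mutinfo_ge0 (B : finType) (g : S -> B) :
  0 <= cond_mutinfo joint (ra \o snd) fst (g \o snd) * ln 2.
Proof.
rewrite cond_mutinfoE -big_split /=.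
rewrite (eq_bigr (fun t => joint t *
  ln (cover_ratio t / side_ratio g t.1 (g t.2)))); last first.
  move=> t _; rewrite -mulrDr.
  have [->|tn0] := eqVneq (joint t) 0; first by rewrite !mul0r.
  have t0 : 0 < joint t by rewrite lt_neqAle eq_sym tn0 joint_ge0.
  by rewrite lnM ?posrE ?invr_gt0 ?cover_ratio_gt0 ?side_ratio_gt0.
apply: gibbs => [|t t0|]; first exact: joint_pmf.
  by rewrite divr_gt0 ?cover_ratio_gt0 ?side_ratio_gt0.
apply: le_trans (side_ratio_mass g).
rewrite (joint_mean (fun w s => (cover_ratio (w, s) / side_ratio g w (g s))^-1)).
apply: ler_sum => s _; rewrite ler_wpM2l //; apply: ler_sum => w _.
rewrite invf_div /cover_ratio /= invf_div mulrCA.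
rewrite [X in _ <= X]mulrC; apply: ler_wpM2l; first exact: side_ratio_ge0.
by apply: mul_div_le; case: pW_pmf.
Qed.

Lemma cond_entropy_ge0 (C B : finType) (f : S -> C) (g : S -> B) :
  0 <= cond_entropy joint (f \o snd) (pairRV fst (g \o snd)) * ln 2.
Proof.
rewrite cond_entropyE; apply: gibbs => [|t t0|]; first exact: joint_pmf.
  by rewrite invr_gt0 cond_prob_gt0.
have [_ p1] := joint_pmf; rewrite -[X in _ <= X]p1; apply: ler_sum => t _.
rewrite invrK -[X in _ <= X]mulr1 ler_wpM2l ?joint_ge0 //.
apply: le_trans (cond_prob_mass f g t.1 (g t.2)).
rewrite (bigD1 (f t.2)) //= lerDl.
by apply: sumr_ge0 => *; apply: cond_prob_ge0.
Qed.

End SingleLetter.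

(** * Block code *)

Section BlockCode.
Variable R : realType.

Lemma joint_aep (T K : finType) (mu : T -> R) (r : K -> T -> R) (e delta : R) :
  is_pmf mu -> (forall j t, 0 < mu t -> 0 < r j t) -> 0 < e -> 0 < delta ->
  exists N, forall n, (N <= n)%N ->
  \sum_(z : {ffun 'I_n -> T}) prodm mu z *
    (~~ ((prodm mu z != 0) && [forall j, \prod_i r j (z i) <=
       expR (n%:R * (\sum_t mu t * ln (r j t) + e))]))%:R <= delta.
Proof.
(* Equal shares for the union bound over [K]; the successor keeps the denominator nonzero. *)
move=> mu_pmf r0 e0 d0; pose d := delta / #|K|.+1%:R.
have dgt0 : 0 < d by rewrite divr_gt0.
have [N HN] := choice (fun j => aep mu_pmf (r0 j) e0 dgt0).
exists (\max_j N j) => n Nn.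
apply: (@le_trans _ _ (\sum_(j : K) d)); last first.
  rewrite sumr_const -[d *+ _]mulr_natr /d mulrAC ler_pdivrMr //.
  by rewrite ler_wpM2l ?(ltW d0) // ler_nat.
apply: (@le_trans _ _ (\sum_j \sum_(z : {ffun 'I_n -> T}) prodm mu z *
     (expR (n%:R * (\sum_t mu t * ln (r j t) + e)) < \prod_i r j (z i))%R%:R));
  last first.
  apply: ler_sum => j _; apply: HN; apply: leq_trans Nn.
  exact: (leq_bigmax j).
rewrite exchange_big /=; apply: ler_sum => z _.
have z0 : 0 <= prodm mu z := (prodm_pmf 'I_n mu_pmf).1 z.
rewrite -mulr_sumr; have [->|_] := eqVneq (prodm mu z) 0; first by rewrite !mul0r.
rewrite ler_wpM2l //=; case: forallP => [_|/forallP]; first by apply: sumr_ge0.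
rewrite negb_forall => /existsP[j]; rewrite -ltNge => h.
by rewrite (bigD1 j) //= h lerDl sumr_ge0.
Qed.

Lemma prodm_pair (I A B : finType) (F : {ffun I -> A * B} -> R) :
  \sum_z F z = \sum_(s : {ffun I -> B}) \sum_(w : {ffun I -> A})
    F [ffun i => (w i, s i)].
Proof.
rewrite exchange_big pair_big /=.
apply: (reindex (fun ws : {ffun I -> A} * {ffun I -> B} =>
  [ffun i => (ws.1 i, ws.2 i)])).
exists (fun z : {ffun I -> A * B} =>
  ([ffun i => (z i).1], [ffun i => (z i).2])) => [[w s]|z] _ /=.
  by congr (_, _); apply/ffunP => i; rewrite !ffunE.
by apply/ffunP => i; rewrite !ffunE -surjective_pairing.
Qed.

Lemma expR_decay (e delta : R) : 0 < e -> 0 < delta ->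
  exists N, forall n, (N <= n)%N -> expR (- (n%:R * e)) <= delta.
Proof.
move=> e0 d0; exists (Num.truncn (e^-1 / delta)).+1 => n Nn.
have n0 : 0 < n%:R :> R by rewrite ltr0n (leq_trans _ Nn).
rewrite expRN; apply: (@le_trans _ _ (n%:R * e)^-1).
  rewrite lef_pV2 ?posrE ?expR_gt0 ?mulr_gt0 //.
  by apply: le_trans (expR_ge1Dx _); rewrite lerDr.
rewrite invfM mulrC ler_pdivrMr // -ler_pdivrMl // mulrC.
by apply: ltW; apply: lt_le_trans (truncnS_gt _) _; rewrite ler_nat.
Qed.

Variables (S X Y U V W : finType) (q : S -> R).
Variables (rx : S -> X) (ry : S -> Y) (ru : S -> U) (rv : S -> V).
Variable k : W -> X * Y -> R.
Let rxy s := (rx s, ry s).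
Hypotheses (q_pmf : is_pmf q).
Hypotheses (k_ge0 : forall w z, 0 <= k w z) (k_sum : forall z, \sum_w k w z = 1).

Let p := joint q rxy k.
Let p_pmf : is_pmf p := joint_pmf rxy q_pmf k_ge0 k_sum.

(* [None]: covering of (x, y) by w; [Some (b, true)]: information between w
   and the side information of receiver [b]; [Some (b, false)]: conditional
   probability of the source wanted by receiver [b]. *)
Definition typ_ratio (j : option (bool * bool)) (t : W * S) : R :=
  match j with
  | None => cover_ratio q rxy k t
  | Some (true, true) => (side_ratio q rxy k ru t.1 (ru t.2))^-1
  | Some (false, true) => (side_ratio q rxy k rv t.1 (rv t.2))^-1
  | Some (true, false) => (cond_prob q rxy k rx ru t.1 (ru t.2) (rx t.2))^-1
  | Some (false, false) => (cond_prob q rxy k ry rv t.1 (rv t.2) (ry t.2))^-1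
  end.

(** In nats: the mutual information of [W] and [(X, Y)] at [None], minus that of [W] and the side
    information at [Some (b, true)], a conditional entropy at [Some (b, false)]. *)
Let D j := \sum_t p t * ln (typ_ratio j t).

Lemma typ_ratio_gt0 j t : 0 < p t -> 0 < typ_ratio j t.
Proof.
move=> t0; case: j => [[[] []]|] /=; rewrite ?invr_gt0.
- exact: (side_ratio_gt0 q_pmf k_ge0 k_sum t0).
- exact: (cond_prob_gt0 q_pmf k_ge0 t0).
- exact: (side_ratio_gt0 q_pmf k_ge0 k_sum t0).
- exact: (cond_prob_gt0 q_pmf k_ge0 t0).
- exact: (cover_ratio_gt0 q_pmf k_ge0 t0).
Qed.

Section Block.
Variables (n : nat) (e : R).
Local Notation blk T := {ffun 'I_n -> T}.
Definition mapf (A B : Type) (f : A -> B) (s : blk A) : blk B :=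
  [ffun i => f (s i)].

(** Nonzero probability makes every letter ratio positive, so that the products can be inverted. *)
Definition typical (z : blk (W * S)) : bool :=
  (prodm p z != 0) &&
  [forall j, \prod_i typ_ratio j (z i) <= expR (n%:R * (D j + e))].

Definition block_kernel (w : blk W) (z : blk X * blk Y) : R :=
  \prod_i k (w i) (z.1 i, z.2 i).

Definition good (w : blk W) (s : blk S) : bool := typical [ffun i => (w i, s i)].

Definition side_test (B : finType) (g : S -> B) (c : R) (w : blk W) (u : blk B) :=
  expR (- c) <= \prod_i side_ratio q rxy k g (w i) (u i).

Definition source_test (C B : finType) (f : S -> C) (g : S -> B) (c : R)
    (w : blk W) (u : blk B) (x : blk C) :=
  expR (- c) <= \prod_i cond_prob q rxy k f g (w i) (u i) (x i).

Lemma good_gt0 w s i : good w s -> 0 < p (w i, s i).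
Proof.
case/andP => h _; rewrite lt_neqAle (proj1 p_pmf) andbT eq_sym.
apply: contraNneq h => h0.
by rewrite /prodm (bigD1 i) //= ffunE h0 mul0r.
Qed.

Lemma good_ratio j w s : good w s ->
  \prod_i typ_ratio j (w i, s i) <= expR (n%:R * (D j + e)).
Proof.
case/andP => _ /forallP /(_ j); by under eq_bigr do rewrite ffunE.
Qed.

Lemma good_cover w s : good w s ->
  block_kernel w (mapf rx s, mapf ry s) <=
  expR (n%:R * (D None + e)) * prodm (pW q rxy k) w.
Proof.
move=> gs; have := good_ratio None gs.
have W0 : 0 <= prodm (pW q rxy k) w.
  by apply: prodr_ge0 => i _; case: (pW_pmf rxy q_pmf k_ge0 k_sum).
move/(ler_wpM2r W0); apply: le_trans; rewrite -big_split /=.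
apply: ler_prod => i _; rewrite k_ge0 !ffunE /= /cover_ratio mulfVK //.
by rewrite gt_eqF // (pW_gt0 q_pmf k_ge0 (good_gt0 i gs)).
Qed.

Lemma inv_prod_expR (I : finType) (F : I -> R) (c : R) :
  (forall i, 0 < F i) -> \prod_i (F i)^-1 <= expR c -> expR (- c) <= \prod_i F i.
Proof.
move=> F0; rewrite prodfV expRN => h.
by rewrite -[X in _ <= X]invrK lef_pV2 ?posrE ?expR_gt0 ?invr_gt0 ?prodr_gt0.
Qed.

Lemma good_side (B : finType) (g : S -> B) j w s :
  (forall t, typ_ratio j t = (side_ratio q rxy k g t.1 (g t.2))^-1) ->
  good w s -> side_test g (n%:R * (D j + e)) w (mapf g s).
Proof.
move=> jE gs; have := good_ratio j gs.
under eq_bigr do rewrite jE.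
move/inv_prod_expR; rewrite /side_test.
under [X in _ -> _ <= X]eq_bigr do rewrite ffunE.
by apply=> i; apply: (side_ratio_gt0 q_pmf k_ge0 k_sum (good_gt0 i gs)).
Qed.

Lemma good_source (C B : finType) (f : S -> C) (g : S -> B) j w s :
  (forall t, typ_ratio j t = (cond_prob q rxy k f g t.1 (g t.2) (f t.2))^-1) ->
  good w s -> source_test f g (n%:R * (D j + e)) w (mapf g s) (mapf f s).
Proof.
move=> jE gs; have := good_ratio j gs.
under eq_bigr do rewrite jE.
move/inv_prod_expR; rewrite /source_test.
under [X in _ -> _ <= X]eq_bigr do rewrite !ffunE.
by apply=> i; apply: (cond_prob_gt0 q_pmf k_ge0 (good_gt0 i gs)).
Qed.

(** Markov's inequality in pointwise form, before summation. *)
Lemma indicator_le_expR (c Z : R) : 0 <= Z ->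
  (expR (- c) <= Z)%R%:R <= expR c * Z.
Proof.
move=> Z0; case: (leP (expR (- c)) Z) => [h|_]; last by rewrite mulr_ge0 ?expR_ge0.
by rewrite mulrC -ler_pdivrMr ?expR_gt0 // mul1r -expRN.
Qed.

(** After the pointwise Markov bound the sum factors over letters, and each factor is at most 1 by
    [side_ratio_mass]. *)
Lemma side_test_prob (B : finType) (g : S -> B) (c : R) :
  \sum_s prodm q s * (\sum_w prodm (pW q rxy k) w *
    (side_test g c w (mapf g s))%:R) <= expR c.
Proof.
have q0 := prodm_pmf 'I_n q_pmf.
have pWn := prodm_pmf 'I_n (pW_pmf rxy q_pmf k_ge0 k_sum).
apply: (@le_trans _ _ (expR c * \sum_(s : blk S) \sum_(w : blk W)
    \prod_i (q (s i) * (pW q rxy k (w i) * side_ratio q rxy k g (w i) (g (s i)))))).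
  rewrite mulr_sumr; apply: ler_sum => s _; rewrite !mulr_sumr.
  apply: ler_sum => w _; rewrite 2!big_split /=.
  rewrite [X in _ <= X]mulrCA ler_wpM2l ?(proj1 q0) //.
  rewrite [X in _ <= X]mulrCA ler_wpM2l ?(proj1 pWn) //.
  rewrite /side_test; under eq_bigr do rewrite ffunE.
  apply: indicator_le_expR; apply: prodr_ge0 => i _.
  exact: (side_ratio_ge0 rxy q_pmf k_ge0).
rewrite -[X in _ <= X]mulr1 ler_wpM2l ?expR_ge0 //.
under eq_bigr => s _ do rewrite (sum_ffun_prod
  (fun i w => q (s i) * (pW q rxy k w * side_ratio q rxy k g w (g (s i))))).
rewrite (sum_ffun_prod (fun i s => \sum_w
  q s * (pW q rxy k w * side_ratio q rxy k g w (g s)))).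
apply: prodr_ile1 => i _; apply/andP; split.
  apply: sumr_ge0 => s _; apply: sumr_ge0 => w _.
  apply: mulr_ge0; last apply: mulr_ge0.
  - by case: q_pmf.
  - by case: (pW_pmf rxy q_pmf k_ge0 k_sum).
  - exact: (side_ratio_ge0 rxy q_pmf k_ge0).
under eq_bigr do rewrite -mulr_sumr.
exact: (side_ratio_mass rxy q_pmf k_ge0 k_sum).
Qed.

(** Conditional probabilities sum to at most 1, so few words can have one above the threshold. *)
Lemma source_test_card (C B : finType) (f : S -> C) (g : S -> B) (c : R) w u :
  \sum_x (source_test f g c w u x)%:R <= expR c.
Proof.
have c0 i x := @cond_prob_ge0 R S W _ q rxy k q_pmf k_ge0 _ _ f g (w i) (u i) x.
apply: (@le_trans _ _ (expR c * \sum_(x : blk C)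
    \prod_i cond_prob q rxy k f g (w i) (u i) (x i))).
  rewrite mulr_sumr; apply: ler_sum => x _.
  by apply: indicator_le_expR; apply: prodr_ge0.
rewrite -[X in _ <= X]mulr1 ler_wpM2l ?expR_ge0 //.
rewrite (sum_ffun_prod (fun i x => cond_prob q rxy k f g (w i) (u i) x)).
apply: prodr_ile1 => i _; rewrite sumr_ge0 //=.
exact: cond_prob_mass.
Qed.

(** Block kernel times source law is the product law of the pairs, which turns the AEP bound into
    the hypothesis [G_prob]. *)
Lemma bad_prob :
  \sum_s prodm q s * (\sum_w block_kernel w (mapf rx s, mapf ry s) *
    (~~ good w s)%:R) = \sum_z prodm p z * (~~ typical z)%:R.
Proof.
rewrite prodm_pair; apply: eq_bigr => s _; rewrite mulr_sumr.
apply: eq_bigr => w _; rewrite /good mulrA; congr (_ * _).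
rewrite mulrC /block_kernel /prodm -big_split; apply: eq_bigr => i _ /=.
by rewrite !ffunE.
Qed.

Hypothesis e_gt0 : 0 < e.
Variables (R0 R1 R2 tau : R).
Hypothesis R0U : D None + D (Some (true, true)) <= R0.
Hypothesis R0V : D None + D (Some (false, true)) <= R0.
Hypothesis R1U : D (Some (true, false)) <= R1.
Hypothesis R2V : D (Some (false, false)) <= R2.
Hypothesis tau_gt0 : 0 < tau.
Hypothesis atypical_prob : \sum_z prodm p z * (~~ typical z)%:R <= tau ^+ 2.

(** Of the margin [e *+ 4], the codebook size takes two, the side test one, and the last gives
    exponential decay. *)
Definition msize (r : R) : nat := Num.truncn (expR (n%:R * (r + e *+ 4))).

Lemma msize_gt r : expR (n%:R * (r + e *+ 4)) < (msize r).+1%:R.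
Proof. exact: truncnS_gt. Qed.

Lemma block_code :
  exists (e0 : blk X -> blk Y -> 'I_(msize R0).+1)
    (e1 : blk X -> 'I_(msize R1).+1) (e2 : blk Y -> 'I_(msize R2).+1)
    (dx : 'I_(msize R0).+1 -> 'I_(msize R1).+1 -> blk U -> blk X)
    (dy : 'I_(msize R0).+1 -> 'I_(msize R2).+1 -> blk V -> blk Y),
  \sum_s prodm q s *
    (dx (e0 (mapf rx s) (mapf ry s)) (e1 (mapf rx s)) (mapf ru s) != mapf rx s)%:R +
  \sum_s prodm q s *
    (dy (e0 (mapf rx s) (mapf ry s)) (e2 (mapf ry s)) (mapf rv s) != mapf ry s)%:R
  <= tau *+ 4 + (tau ^+ 2) *+ 2 + expR (- (n%:R * e)) *+ 8.
Proof.
have pWp := pW_pmf rxy q_pmf k_ge0 k_sum.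
pose L := Num.truncn (expR (n%:R * (D None + e *+ 2))).
have Lgt : expR (n%:R * (D None + e *+ 2)) < L.+1%:R by exact: truncnS_gt.
(* The truncation plus one is at most twice the exponential, as the exponent is nonnegative. *)
have Lle : L.+1%:R <= expR (n%:R * (D None + e *+ 2)) *+ 2.
  rewrite -natr1 mulr2n lerD ?truncn_le ?expR_ge0 //.
  rewrite -[X in X <= _]expR0 ler_expR mulr_ge0 // addr_ge0 ?mulrn_wge0 ?(ltW e_gt0) //.
  exact: (cover_info_ge0 rxy q_pmf k_ge0 k_sum).
have kn0 (w : blk W) z : 0 <= block_kernel w z by apply: prodr_ge0.
have kn1 z : \sum_(w : blk W) block_kernel w z = 1.
  by rewrite (sum_ffun_prod (fun i w => k w (z.1 i, z.2 i))) big1.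
have bad_le := atypical_prob; rewrite -bad_prob in bad_le.
have [e0 [e1 [e2 [dx [dy err]]]]] :=
  one_shot_code (prodm_pmf 'I_n q_pmf) (prodm_pmf 'I_n pWp) kn0 kn1
    (expR_gt0 _) tau_gt0 (fun w s => @good_cover w s)
    (fun w s => @good_side U ru (Some (true, true)) w s (fun=> erefl))
    (fun w s => @good_side V rv (Some (false, true)) w s (fun=> erefl))
    (fun w s => @good_source X U rx ru (Some (true, false)) w s (fun=> erefl))
    (fun w s => @good_source Y V ry rv (Some (false, false)) w s (fun=> erefl))
    bad_le (side_test_prob ru _) (side_test_prob rv _)
    (@source_test_card X U rx ru _) (@source_test_card Y V ry rv _)
    L (msize R0) (msize R1) (msize R2).
exists e0, e1, e2, dx, dy; apply: (le_trans err).
set E := expR (- _).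
(* A gap of [e] between the exponents makes the quotient at most [E]. *)
have quot (x y m : R) : n%:R * (x + e) <= y -> expR y < m ->
    expR (n%:R * x) / m <= E.
  move=> xy ym; rewrite ler_pdivrMr ?(lt_trans (expR_gt0 y)) //.
  apply: (@le_trans _ _ (E * expR y)); last by rewrite ler_wpM2l ?expR_ge0 // ltW.
  rewrite /E -expRD ler_expR; move: xy; rewrite mulrDr; lra.
have n0 : 0 <= n%:R :> R by [].
have cov : expR (n%:R * (D None + e)) / L.+1%:R <= E.
  by apply: quot Lgt; rewrite ler_wpM2l // -addrA mulr2n.
have src j (r : R) : D j <= r -> expR (n%:R * (D j + e)) / (msize r).+1%:R <= E.
  by move=> jr; apply: quot (msize_gt r); rewrite ler_wpM2l //; move: e_gt0; lra.
have side j : D None + D j <= R0 ->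
    L.+1%:R * expR (n%:R * (D j + e)) / (msize R0).+1%:R <= E *+ 2.
  move=> jr; apply: (@le_trans _ _
    ((expR (n%:R * (D None + D j + e *+ 3)) / (msize R0).+1%:R) *+ 2)).
    rewrite -mulrnAl ler_wpM2r ?invr_ge0 //.
    apply: le_trans (ler_wpM2r (expR_ge0 _) Lle) _.
    rewrite [X in X <= _]mulrnAl -expRD lerMn2r /= ler_expR -mulrDr ler_wpM2l //.
    by move: e_gt0; lra.
  rewrite lerMn2r /=; apply: quot (msize_gt R0).
  by rewrite ler_wpM2l //; move: e_gt0; lra.
rewrite [L.+1%:R * (_ + _)]mulrDr [(_ + _) / (msize R0).+1%:R]mulrDl.
(* The eight [E]: two for covering, four for false codewords, one for each source hash. *)
rewrite (_ : _ + E *+ 8 =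
  (tau + tau ^+ 2 + E + tau) *+ 2 + (E *+ 2 + E *+ 2) + E + E); last by ring.
apply: lerD (src _ _ R2V); apply: lerD (src _ _ R1U).
apply: lerD (lerD (side _ R0U) (side _ R0V)).
by rewrite lerMn2r /= lerD2r lerD2l.
Qed.

End Block.
End BlockCode.

(** * Rates in bits and passage to the closure *)

Section Achievability.
Variable R : realType.

Lemma law_reindex (T T' A : finType) (p : T -> R) (j : T' -> T) (f : T -> A) a :
  bijective j -> law p f a = law (p \o j) (f \o j) a.
Proof. by move=> jb; rewrite /law (reindex j) //; apply: onW_bij. Qed.

Lemma cond_mutinfo_reindex (T T' A B C : finType) (p : T -> R) (j : T' -> T)
    (f : T -> A) (g : T -> B) (h : T -> C) : bijective j ->
  cond_mutinfo p f g h = cond_mutinfo (p \o j) (f \o j) (g \o j) (h \o j).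
Proof.
move=> jb; rewrite /cond_mutinfo; apply: eq_bigr => a _; apply: eq_bigr => b _.
by apply: eq_bigr => c _; rewrite !(law_reindex _ _ _ jb).
Qed.

Lemma cond_entropy_reindex (T T' A B : finType) (p : T -> R) (j : T' -> T)
    (f : T -> A) (g : T -> B) : bijective j ->
  cond_entropy p f g = cond_entropy (p \o j) (f \o j) (g \o j).
Proof.
move=> jb; rewrite /cond_entropy; congr (- _); apply: eq_bigr => a _.
by apply: eq_bigr => b _; rewrite !(law_reindex _ _ _ jb).
Qed.

(** The margin [e *+ 4] costs [eps / 2] in bits. Rounding at most doubles the size, costing [1 / n],
    which is at most [eps / 2]. *)
Lemma msize_rate n (r eps : R) : (0 < n)%N -> 0 <= r -> 0 < eps -> 2 / eps <= n%:R ->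
  log2 (msize n (eps * ln 2 / 8) (r * ln 2)).+1%:R / n%:R <= r + eps.
Proof.
move=> n_gt0 r0 eps0 neps; have l2 := ln2_gt0 R.
have n0 : 0 < n%:R :> R by rewrite ltr0n.
set x := n%:R * (r * ln 2 + (eps * ln 2 / 8) *+ 4).
have x0 : 0 <= x.
  by rewrite mulr_ge0 ?addr_ge0 ?mulrn_wge0 ?divr_ge0 ?mulr_ge0 // ltW.
rewrite /log2 ler_pdivrMr // ler_pdivrMr //.
apply: (@le_trans _ _ (ln (expR x * 2))).
  rewrite ler_ln ?posrE ?mulr_gt0 ?expR_gt0 // mulr_natr -natr1 mulr2n.
  rewrite lerD ?truncn_le ?expR_ge0 //.
  by rewrite -[X in X <= _]expR0 ler_expR.
rewrite lnM ?posrE ?expR_gt0 // expRK.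
move: neps; rewrite ler_pdivrMr // => neps.
rewrite (_ : x = (n%:R * r + n%:R * eps / 2) * ln 2); last by rewrite /x; field.
rewrite -[X in _ + X]mul1r -mulrDl ler_wpM2r ?(ltW l2) //.
rewrite [_ * n%:R]mulrC mulrDr -addrA lerD2l; lra.
Qed.

Variables X Y U V W : finType.
Variable Q : X * Y * U * V -> R.
Hypothesis Q_pmf : is_pmf Q.

Lemma iid_probE n (E : pred {ffun 'I_n -> X * Y * U * V}) :
  iid_prob Q E = \sum_s prodm Q s * (E s)%:R.
Proof.
by rewrite /iid_prob big_mkcond; apply: eq_bigr => s _; rewrite mulr_natr mulrb.
Qed.

Lemma Rin_p_achievable (p : W * X * Y * U * V -> R) r :
  in_P Q p -> Rin_p p r -> achievable Q r.
Proof.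
move=> [_ [[k [k0 [k1 pE]]] _]] [r0 r1 r2] eps eps0.
pose S : finType := (X * Y * U * V)%type.
(* Reorders the nested tuple so that the source letter becomes one component. *)
pose j (t : W * S) := ((((t.1, t.2.1.1.1), t.2.1.1.2), t.2.1.2), t.2.2).
have jb : bijective j.
  exists (fun t => (t.1.1.1.1, (((t.1.1.1.2, t.1.1.2), t.1.2), t.2))).
    by move=> [w [[[x y] u] v]].
  by move=> [[[[w x] y] u] v].
pose rx (s : S) := s.1.1.1; pose ry (s : S) := s.1.1.2.
pose ru (s : S) := s.1.2; pose rv (s : S) := s.2.
pose rxy s := (rx s, ry s).
pose k' w (z : X * Y) := k w z.1 z.2.
have k'0 w z : 0 <= k' w z by exact: k0.
have k'1 z : \sum_w k' w z = 1 by exact: k1.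
have pj : p \o j = joint Q rxy k'.
  by apply/funext => -[w [[[x y] u] v]]; rewrite /= pE.
move: r0; rewrite ge_max !(cond_mutinfo_reindex _ _ _ _ jb) pj => /andP[r0U r0V].
move: r1 r2; rewrite !(cond_entropy_reindex _ _ _ jb) pj => r1 r2.
have l2 := ln2_gt0 R.
have {}r0U := ler_wpM2r (ltW l2) r0U; have {}r0V := ler_wpM2r (ltW l2) r0V.
have {}r1 := ler_wpM2r (ltW l2) r1; have {}r2 := ler_wpM2r (ltW l2) r2.
(* [msize_rate] needs nonnegative rates, which follow from nonnegativity of the information
   quantities. *)
have r0_ge0 : 0 <= r.1.1.
  rewrite -(pmulr_lge0 _ l2); apply: le_trans r0U.
  exact: (cond_mutinfo_ge0 rxy Q_pmf k'0 k'1 ru).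
have r1_ge0 : 0 <= r.1.2.
  rewrite -(pmulr_lge0 _ l2); apply: le_trans r1.
  exact: (cond_entropy_ge0 rxy Q_pmf k'0 k'1 rx ru).
have r2_ge0 : 0 <= r.2.
  rewrite -(pmulr_lge0 _ l2); apply: le_trans r2.
  exact: (cond_entropy_ge0 rxy Q_pmf k'0 k'1 ry rv).
rewrite (cond_mutinfoE rxy Q_pmf k'0 k'1 ru) in r0U.
rewrite (cond_mutinfoE rxy Q_pmf k'0 k'1 rv) in r0V.
rewrite (cond_entropyE rxy Q_pmf k'0 rx ru) in r1.
rewrite (cond_entropyE rxy Q_pmf k'0 ry rv) in r2.
pose e := eps * ln 2 / 8; have e0 : 0 < e by rewrite divr_gt0 // mulr_gt0.
(* With [tau ^+ 2 <= tau], the error is at most six [tau] plus eight exponentials of at most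
   [eps / 16] each. *)
pose tau := Num.min 1 (eps / 16).
have tau0 : 0 < tau by rewrite lt_min ltr01 divr_gt0.
have [tau1 taueps] : tau <= 1 /\ tau <= eps / 16.
  by rewrite /tau !ge_min !lexx orbT.
have [N1 HN1] := joint_aep (joint_pmf rxy Q_pmf k'0 k'1)
  (@typ_ratio_gt0 R S X Y U V W Q rx ry ru rv k' Q_pmf k'0 k'1)
  e0 (exprn_gt0 2 tau0).
have [N2 HN2] := expR_decay e0 (divr_gt0 eps0 (ltr0n R 16)).
exists (maxn (maxn N1 N2) (Num.truncn (2 / eps)).+1) => n.
rewrite !geq_max => /andP[/andP[n1 n2] n3].
have n_gt0 : (0 < n)%N by apply: leq_trans n3.
have n3' : 2 / eps <= n%:R.
  by apply: ltW; apply: lt_le_trans (truncnS_gt _) _; rewrite ler_nat.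
have [e0' [e1 [e2 [dx [dy err]]]]] := block_code Q_pmf k'0 k'1 e0
  r0U r0V r1 r2 tau0 (HN1 n n1).
exists (msize n e (r.1.1 * ln 2)).+1, (msize n e (r.1.2 * ln 2)).+1,
  (msize n e (r.2 * ln 2)).+1.
exists (Code (fun x y => (e0' x y, e1 x, e2 y)) dx dy).
split; try exact: msize_rate.
have err_le : tau *+ 4 + tau ^+ 2 *+ 2 + expR (- (n%:R * e)) *+ 8 <= eps.
  have tau2 : tau ^+ 2 <= tau by rewrite expr2 ler_piMl // ltW.
  have := HN2 n n2; lra.
apply: le_trans err_le; apply: le_trans err.
rewrite /Pe /err_x /err_y !iid_probE ge_max lerDl lerDr.
by apply/andP; split; apply: sumr_ge0 => s _; rewrite mulr_ge0 //;
  case: (prodm_pmf 'I_n Q_pmf).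
Qed.

End Achievability.

Theorem theorem2 (R : realType) (X Y U V W : finType)
  (Q : X * Y * U * V -> R) (HQ : is_pmf Q)
  (HW : (#|W| <= #|X| * #|Y| + 3)%N) :
  Rin Q W `<=` rate_region Q.
Proof.
move=> r r_cl eps eps0.
have e2 : 0 < eps / 2 by rewrite divr_gt0.
(* A point of the union within [eps / 2] in each coordinate; a code for it with tolerance [eps / 2]
   serves [r] with tolerance [eps]. *)
have [r' [[p pP r'p] [[b0 b1] b2]]] := r_cl _ (nbhsx_ballx r _ e2).
have close (x y : R) : ball x (eps / 2) y -> y <= x + eps / 2.
  by rewrite /ball /= ltr_distl => /andP[]; lra.
have [N HN] := Rin_p_achievable HQ pP r'p e2.
exists N => n Nn; have [m0 [m1 [m2 [c [pe h0 h1 h2]]]]] := HN n Nn.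
exists m0, m1, m2, c.
have c0 := close _ _ b0; have c1 := close _ _ b1; have c2 := close _ _ b2.
by split; lra.
Qed.
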